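(* Let $g\in\mathbb{C}[[x,y]]$ be a formal power series in two variables $x,y$, let $h\in\mathbb{C}[[x]]$ be a non-zero convergent power series with $h(0)=0$, let $E$ be a closed subset of $\mathbb{C}\setminus\{0\}$ with $\operatorname{cap}(E)>0$, and let $(\sigma,\tau)$ be a pair of integers with $(\sigma,\tau)\neq(0,0)$. Assume, in case $\sigma\tau>0$, that $h(x)$ is not a monomial of the form $b_kx^k$ with $\sigma k-\tau=0$. Suppose that $g(s^\sigma x,s^\tau h(x))$ is convergent for each $s\in E$. Then $g$ is convergent.
   Context: $\mathbb{C}[[x_1,\dots,x_n]]$ is the set of formal power series $\sum a_{k_1\dots k_n}x_1^{k_1}\cdots x_n^{k_n}$ with complex coefficients; $g(0)$ denotes the constant coefficient of $g$. A power series is convergent if there is a constant $C$ such that $|a_{k_1\dots k_n}|\le C^{k_1+\cdots+k_n}$ for all $(k_1,\dots,k_n)\ne(0,\dots,0)$ (equivalently, it converges in some neighborhood of the origin). For $s\in\mathbb{C}\setminus\{0\}$ and $h(0)=0$, $g(s^\sigma x,s^\tau h(x))$ is the well-defined element of $\mathbb{C}[[x]]$ obtained by formal substitution. $\operatorname{cap}$ denotes logarithmic capacity: for a compact set $E\subset\mathbb{C}$, $\operatorname{cap}(E)=\exp\left(-\min_{\mu}\sup_{z\in\mathbb{C}}p_\mu(z)\right)$, where $\mu$ ranges over probability measures on $E$ and $p_\mu(z)=\lim_{N\to\infty}\int\min\left(N,\log\frac{1}{|z-\zeta|}\right)d\mu(\zeta)$ (equal to the transfinite diameter of $E$); for a closed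 set $E$, $\operatorname{cap}(E)=\lim_n\operatorname{cap}(E\cap\{|z|\le n\})$. *)

(* Defs.v *)
From HB Require Import structures.
From mathcomp Require Export all_boot all_order all_algebra.
From mathcomp Require Export complex.
From mathcomp Require Export all_classical all_reals all_analysis.
Export Order.TTheory GRing.Theory Num.Theory numFieldNormedType.Exports.

Set Implicit Arguments.
Unset Strict Implicit.
Unset Printing Implicit Defensive.

Local Open Scope classical_set_scope.
Local Open Scope ring_scope.

(* [R[i]] seen as a [numClosedFieldType], which is what gives it the library's
   norm topology on number fields. *)
Definition Cx (R : realType) : numClosedFieldType := R[i]%C.

(* The modulus, with values in [R] (the generic norm [`|z|] lives in [R[i]]). *)
Definition cabs (R : realType) (z : Cx R) : R := ComplexField.Normc.normc z.

(* A formal power series is its family of coefficients. *)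
Definition ps1 (R : realType) : Type := nat -> Cx R.
Definition ps2 (R : realType) : Type := nat -> nat -> Cx R.

Section FormalPowerSeries.
Context {R : realType}.
Implicit Types (u v : ps1 R) (g : ps2 R).

Definition ps1_convergent u : Prop :=
  exists C : R, forall n : nat, n != 0%N -> cabs (u n) <= C ^+ n.

Definition ps2_convergent g : Prop :=
  exists C : R, forall i j : nat,
    (i, j) != (0%N, 0%N) -> cabs (g i j) <= C ^+ (i + j).

Definition ps1_monomial (b : Cx R) (k : nat) : ps1 R :=
  fun n => if n == k then b else 0.

Definition ps1_scale (c : Cx R) u : ps1 R := fun n => c * u n.

Definition ps1_mul u v : ps1 R :=
  fun n => \sum_(i < n.+1) u i * v (n - i)%N.

Definition ps1_exp u (k : nat) : ps1 R :=
  iter k (ps1_mul u) (ps1_monomial 1 0).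

(* The formal substitution g(u(x), v(x)), meaningful when u(0) = v(0) = 0: then
   u^i v^j has order at least i + j, so the terms with i > n or j > n do not
   contribute to the coefficient of x^n; see [ps2_subst_trunc]. *)
Definition ps2_subst g u v : ps1 R :=
  fun n => \sum_(i < n.+1) \sum_(j < n.+1)
    g i j * ps1_mul (ps1_exp u i) (ps1_exp v j) n.

Lemma ps1_mul_order u v (a b : nat) :
  (forall m : nat, (m < a)%N -> u m = 0) ->
  (forall m : nat, (m < b)%N -> v m = 0) ->
  forall n : nat, (n < a + b)%N -> ps1_mul u v n = 0.
Proof.
move=> hu hv n hn; rewrite /ps1_mul big1 // => i _.
case: (ltnP i a) => hia; first by rewrite hu // mul0r.
rewrite hv ?mulr0 // ltn_subLR; last by rewrite -ltnS.
by rewrite (leq_trans hn) // leq_add2r.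
Qed.

Lemma ps1_exp_order u (k : nat) :
  u 0%N = 0 -> forall n : nat, (n < k)%N -> ps1_exp u k n = 0.
Proof.
move=> u0; elim: k => [//|k IH] n hn.
apply: (@ps1_mul_order u (ps1_exp u k) 1 k) => // [[|m]] //.
Qed.

Lemma ps2_subst_trunc g u v : u 0%N = 0 -> v 0%N = 0 ->
  forall n N : nat, (n <= N)%N ->
  ps2_subst g u v n = \sum_(i < N.+1) \sum_(j < N.+1)
    g i j * ps1_mul (ps1_exp u i) (ps1_exp v j) n.
Proof.
move=> u0 v0 n N nN.
have z (i j : nat) : (n < i + j)%N ->
    ps1_mul (ps1_exp u i) (ps1_exp v j) n = 0.
  by apply: ps1_mul_order; apply: ps1_exp_order.
pose F i j := g i j * ps1_mul (ps1_exp u i) (ps1_exp v j) n.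
have S (G : nat -> Cx R) : (forall i : nat, (n < i)%N -> G i = 0) ->
    \sum_(i < n.+1) G i = \sum_(i < N.+1) G i.
  move=> G0; rewrite (big_ord_widen N.+1 G) // big_mkcond /=.
  by apply: eq_bigr => i _; case: ltnP => // /G0.
rewrite /ps2_subst.
rewrite (S (fun i => \sum_(j < n.+1) F i j)); last first.
  by move=> i ni; rewrite big1 // => j _; rewrite /F z ?mulr0 // ltn_addr.
apply: eq_bigr => i _; apply: (S (F i)) => j nj.
by rewrite /F z ?mulr0 // ltn_addl.
Qed.

End FormalPowerSeries.

Section Capacity.
Context {R : realType}.
Local Open Scope ereal_scope.

(* The complex plane with its Borel sigma-algebra. *)
Definition borelCx : measurableType _ := g_sigma_algebraType (@open (Cx R)).

(* [- lne] is log(1/.) on [0, +oo], with the value +oo at 0. *)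
Definition log_potential (mu : probability borelCx R) (z : Cx R) : \bar R :=
  limn (fun N : nat =>
    \int[mu]_(w in [set: borelCx])
      mine N%:R%:E (- lne (cabs (z - (w : Cx R)))%:E)).

(* The logarithmic capacity of a bounded Borel set [K], by the formula for
   compact sets. The infimum is over all Borel probability measures on [K] (a
   minimum when [K] is compact and non-empty); it is +oo, so that the capacity
   is 0, when [K] is empty. *)
Definition cap_bounded (K : set (Cx R)) : \bar R :=
  expeR (- ereal_inf
    [set ereal_sup [set log_potential mu z | z in [set: Cx R]] |
      mu in [set mu : probability borelCx R | mu K = 1]]).

Definition cap (E : set (Cx R)) : \bar R :=
  limn (fun n : nat => cap_bounded (E `&` [set z | (cabs z <= n%:R)%R])).

End Capacity.

(* Main.v *)
From HB Require Import structures.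
Require Import Defs.
From mathcomp Require Import measurable_realfun.
From mathcomp Require Import ring lra zify.
Set Implicit Arguments.
Unset Strict Implicit.
Unset Printing Implicit Defensive.

(** The coefficient of x^n in g(s^sigma x, s^tau h(x)) is a Laurent polynomial
    P_n(s) with exponents in [- L n, L n], L = |sigma| + |tau|, and the coefficient
    of s^p in P_n is the coefficient of x^n in G_p(x), the sum of the
    g_ij x^i h(x)^j over the line sigma i + tau j = p.  The proof bounds these coefficients, then recovers the
    g_ij from each G_p.

    From E to the lines.  Positive capacity provides a probability measure mu on a
    bounded part of E whose logarithmic potential is bounded above
    ([cap_gt0_measure]).  That part of E is the countable union, over m, of the
    sets where |s^(L n) P_n(s)| <= m^n for all n >= 1, so one of them, K, has
    positive mu-measure.  If a polynomial of degree at most d is bounded by A on K,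
    then the average of its logarithm over K bounds its Mahler measure, hence its
    coefficients, by A B^d, with B depending on mu and K only
    ([coef_le_of_bounded_kernel]).  Thus there is a B with
    |[x^n] G_p| <= B^n for all n >= 1 and all p ([coef_le_of_cap_gt0]).

    From the lines to g.  Write h = b x^k u with b <> 0 and u(0) = 1, so that
    x^i h^j = b^j x^(i + k j) u^j.  If tau <> sigma k, the orders i + k j are
    pairwise distinct along a line and the g_ij come out of G_p one after the
    other; each step multiplies the bounds by a fixed constant, because on a
    small disc multiplication and division by u at most double them
    ([expansion_coef_le], [convergent_transversal]).  If tau = sigma k, a line is
    i + k j = q and G_p is x^q times a polynomial in u; since h is not b x^k,
    w = u - 1 is c x^e v with c <> 0, e >= 1 and v(0) = 1, and the same procedure
    applies to the expansion of that polynomial in powers of w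
    ([convergent_tangent]). *)

Local Open Scope classical_set_scope.
Local Open Scope ring_scope.

(** * The modulus *)

Section Modulus.
Context {R : realType}.
Implicit Types z w : Cx R.

Lemma normr_cabs z : `|z| = (cabs z)%:C%C.
Proof. by []. Qed.

Lemma cabs_ge0 z : 0 <= cabs z.
Proof. by rewrite -(ler0c (cabs z)) -normr_cabs normr_ge0. Qed.

Lemma cabs0 : cabs (0 : Cx R) = 0.
Proof. exact: ComplexField.Normc.normc0. Qed.

Lemma cabs1 : cabs (1 : Cx R) = 1.
Proof. exact: ComplexField.Normc.normc1. Qed.

Lemma cabsM z w : cabs (z * w) = cabs z * cabs w.
Proof. exact: ComplexField.Normc.normcM. Qed.

Lemma cabsV z : cabs z^-1 = (cabs z)^-1.
Proof. exact: ComplexField.Normc.normcV. Qed.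

Lemma cabsN z : cabs (- z) = cabs z.
Proof. exact: (normcN z). Qed.

Lemma cabsD z w : cabs (z + w) <= cabs z + cabs w.
Proof. exact: (le_normcD z w). Qed.

Lemma cabsB z w : cabs (z - w) <= cabs z + cabs w.
Proof. by rewrite (le_trans (cabsD _ _))// cabsN. Qed.

Lemma cabs_distC z w : cabs (z - w) = cabs (w - z).
Proof. by rewrite -cabsN opprB. Qed.

Lemma cabs_eq0 z : (cabs z == 0) = (z == 0).
Proof.
apply/eqP/eqP => [|->]; last exact: cabs0.
exact: ComplexField.Normc.eq0_normc.
Qed.

Lemma cabs_gt0 z : (0 < cabs z) = (z != 0).
Proof. by rewrite lt_neqAle cabs_ge0 andbT eq_sym cabs_eq0. Qed.

Lemma cabsX z n : cabs (z ^+ n) = cabs z ^+ n.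
Proof. by elim: n => [|n IH]; rewrite ?expr0 ?cabs1// !exprS cabsM IH. Qed.

Lemma cabs_sum (I : Type) (r : seq I) (P : pred I) (F : I -> Cx R) :
  cabs (\sum_(i <- r | P i) F i) <= \sum_(i <- r | P i) cabs (F i).
Proof.
elim/big_ind2 : _ => // [|x1 x2 y1 y2 h1 h2]; first by rewrite cabs0.
by rewrite (le_trans (cabsD _ _))// lerD.
Qed.

Lemma cabs_prod (I : Type) (r : seq I) (P : pred I) (F : I -> Cx R) :
  cabs (\prod_(i <- r | P i) F i) = \prod_(i <- r | P i) cabs (F i).
Proof. exact: (big_morph _ cabsM cabs1). Qed.

Lemma poly_prod_coef_le (s : seq (Cx R)) l :
  cabs (\prod_(z <- s) ('X - z%:P))`_l <= \prod_(z <- s) (1 + cabs z).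
Proof.
have P0 (t : seq (Cx R)) : 0 <= \prod_(z <- t) (1 + cabs z).
  by rewrite prodr_ge0// => z _; rewrite addr_ge0// cabs_ge0.
elim: s l => [|z s IH] l.
  by rewrite !big_nil coef1; case: eqP => _; rewrite ?cabs1 ?cabs0.
rewrite !big_cons mulrBl coefB coefXM coefCM.
apply: (le_trans (cabsB _ _)); rewrite mulrDl mul1r cabsM; apply: lerD.
  by case: eqP => _; rewrite ?cabs0//.
by apply: ler_wpM2l; rewrite ?cabs_ge0.
Qed.

End Modulus.

(** * The ring of formal power series *)

Section FpsRing.
Context {R : realType}.

HB.instance Definition _ := gen_eqMixin (ps1 R).
HB.instance Definition _ := gen_choiceMixin (ps1 R).
HB.instance Definition _ := GRing.Zmodule.copy (ps1 R) (nat -> Cx R).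

Implicit Types u v w f : ps1 R.

Lemma ps1P u v : u =1 v <-> u = v.
Proof. by split=> [/funext|->]. Qed.

Definition ps1_trunc N u : {poly Cx R} := \poly_(i < N) u i.

(** Associativity and commutativity of the Cauchy product are inherited from
    polynomials through this identity. *)
Lemma ps1_mul_trunc N u v n : (n < N)%N ->
  ps1_mul u v n = (ps1_trunc N u * ps1_trunc N v)`_n.
Proof.
move=> nN; rewrite coefM; apply: eq_bigr => i _; rewrite !coef_poly.
have iN : (i < N)%N by rewrite (leq_ltn_trans _ nN)// -ltnS.
by rewrite iN (leq_ltn_trans (leq_subr _ _) nN).
Qed.

Lemma ps1_mulC : commutative (@ps1_mul R).
Proof.
by move=> u v; apply/ps1P => n; rewrite !(@ps1_mul_trunc n.+1)// mulrC.
Qed.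

Lemma ps1_mulA : associative (@ps1_mul R).
Proof.
have coefMl (p q r : {poly Cx R}) n : (forall i, (i < n.+1)%N -> p`_i = q`_i) ->
    (p * r)`_n = (q * r)`_n.
  by move=> pq; rewrite !coefM; apply: eq_bigr => i _; rewrite pq.
have tr u v w n : ps1_mul (ps1_mul u v) w n =
    (ps1_trunc n.+1 u * ps1_trunc n.+1 v * ps1_trunc n.+1 w)`_n.
  rewrite (@ps1_mul_trunc n.+1)//; apply: coefMl => i iN.
  by rewrite coef_poly iN (@ps1_mul_trunc n.+1).
move=> u v w; apply/ps1P => n; rewrite ps1_mulC !tr.
by rewrite -[in RHS]mulrA [in RHS]mulrC.
Qed.

Lemma ps1_mul1 : left_id (ps1_monomial 1 0) (@ps1_mul R).
Proof.
move=> u; apply/ps1P => n; rewrite /ps1_mul big_ord_recl/= subn0 mul1r.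
by rewrite big1 ?addr0// => i _; rewrite mul0r.
Qed.

Lemma ps1_mulDl : left_distributive (@ps1_mul R) +%R.
Proof.
move=> u v w; apply/ps1P => n; rewrite /ps1_mul.
under eq_bigr do rewrite mulrDl.
by rewrite big_split.
Qed.

Lemma ps1_1neq0 : ps1_monomial 1 0 != 0 :> ps1 R.
Proof. by apply/eqP => /(congr1 (@^~ 0%N)) /eqP; rewrite oner_eq0. Qed.

HB.instance Definition _ := GRing.Zmodule_isComNzRing.Build (ps1 R)
  ps1_mulA ps1_mulC ps1_mul1 ps1_mulDl ps1_1neq0.

Lemma ps1_coefD u v n : (u + v) n = u n + v n. Proof. by []. Qed.
Lemma ps1_coefN u n : (- u) n = - u n. Proof. by []. Qed.
Lemma ps1_coef1 n : (1 : ps1 R) n = (n == 0%N)%:R.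
Proof. by rewrite /GRing.one/= /ps1_monomial; case: eqP. Qed.
Lemma ps1_coefM u v n : (u * v) n = \sum_(i < n.+1) u i * v (n - i)%N.
Proof. by []. Qed.

Lemma ps1_coef_sum (I : Type) (r : seq I) (P : pred I) (F : I -> ps1 R) n :
  (\sum_(i <- r | P i) F i) n = \sum_(i <- r | P i) F i n.
Proof. exact: (big_morph (fun u : ps1 R => u n)). Qed.

Lemma ps1_coef0M u v : (u * v) 0%N = u 0%N * v 0%N.
Proof. by rewrite ps1_coefM big_ord1. Qed.

Lemma ps1_coef0X u n : (u ^+ n) 0%N = u 0%N ^+ n.
Proof.
elim: n => [|n IH]; first by rewrite !expr0 ps1_coef1.
by rewrite !exprS ps1_coef0M IH.
Qed.

Lemma ps1_expE u k : ps1_exp u k = u ^+ k.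
Proof. by elim: k => [//|k IH]; rewrite exprS -IH. Qed.

Definition ps1C (c : Cx R) : ps1 R := ps1_monomial c 0.

Lemma ps1_coefCM c u n : (ps1C c * u) n = c * u n.
Proof.
rewrite ps1_coefM big_ord_recl/= subn0 big1 ?addr0// => i _.
by rewrite /ps1C/ps1_monomial/= mul0r.
Qed.

Fact ps1C_is_additive : zmod_morphism ps1C.
Proof.
move=> a b; apply/ps1P => -[|n]; rewrite /ps1C ps1_coefD ps1_coefN//=.
by rewrite /ps1_monomial/= subr0.
Qed.
Fact ps1C_is_multiplicative : monoid_morphism ps1C.
Proof.
split=> // a b; apply/ps1P => n; rewrite ps1_coefCM /ps1C /ps1_monomial.
by case: eqP; rewrite ?mulr0.
Qed.
HB.instance Definition _ := GRing.isZmodMorphism.Build (Cx R) (ps1 R)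
  ps1C ps1C_is_additive.
HB.instance Definition _ := GRing.isMonoidMorphism.Build (Cx R) (ps1 R)
  ps1C ps1C_is_multiplicative.

Lemma ps1_scaleE c u : ps1_scale c u = ps1C c * u.
Proof. by apply/ps1P => n; rewrite ps1_coefCM. Qed.

Definition ps1X : ps1 R := ps1_monomial 1 1.

Lemma ps1_coefXM u n : (ps1X * u) n = if n is m.+1 then u m else 0.
Proof.
rewrite ps1_coefM; case: n => [|n]; first by rewrite big_ord1 /ps1X/ps1_monomial/= mul0r.
rewrite 2!big_ord_recl/= big1 ?addr0 => [|i _].
  by rewrite /ps1X/ps1_monomial/= mul0r mul1r add0r subSS subn0.
by rewrite /ps1X/ps1_monomial/= mul0r.
Qed.

Lemma ps1_coefXnM u m n :
  (ps1X ^+ m * u) n = if (n < m)%N then 0 else u (n - m)%N.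
Proof.
elim: m n => [|m IH] n; first by rewrite mul1r subn0.
rewrite exprS -mulrA ps1_coefXM; case: n => [//|n].
by rewrite IH ltnS subSS.
Qed.

Definition ps1_shift m u : ps1 R := fun n => u (n + m)%N.

Lemma ps1_shiftK m u : (forall n, (n < m)%N -> u n = 0) ->
  ps1X ^+ m * ps1_shift m u = u.
Proof.
move=> u0; apply/ps1P => n; rewrite ps1_coefXnM /ps1_shift.
by case: ltnP => [/u0//|mn]; rewrite subnK.
Qed.

(** The geometric series of 1 - u, for u(0) = 1; the powers beyond the n-th do
    not contribute to the coefficient of x^n. *)
Definition ps1_inv1 u : ps1 R := fun n => (\sum_(l < n.+1) (1 - u) ^+ l) n.

Lemma ps1_expr_order u k : u 0%N = 0 -> forall n, (n < k)%N -> (u ^+ k) n = 0.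
Proof. by move=> u0 n nk; rewrite -ps1_expE ps1_exp_order. Qed.

Lemma ps1_mulV1 u : u 0%N = 1 -> ps1_inv1 u * u = 1.
Proof.
move=> u0; have q0 : (1 - u) 0%N = 0.
  by rewrite ps1_coefD ps1_coefN u0 ps1_coef1 subrr.
have qE N n : (n <= N)%N -> ps1_inv1 u n = (\sum_(l < N.+1) (1 - u) ^+ l) n.
  move=> nN; rewrite /ps1_inv1 !ps1_coef_sum.
  rewrite (big_ord_widen N.+1 (fun l => ((1 - u) ^+ l) n))// big_mkcond/=.
  by apply: eq_bigr => i _; case: ltnP => // /ps1_expr_order->.
apply/ps1P => n.
transitivity (((\sum_(l < n.+1) (1 - u) ^+ l) * u) n).
  by rewrite !ps1_coefM; apply: eq_bigr => i _; rewrite (@qE n)// -ltnS.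
have -> : (\sum_(l < n.+1) (1 - u) ^+ l) * u = 1 - (1 - u) ^+ n.+1.
  have := subrXX 1 (1 - u) n.+1; rewrite expr1n => ->.
  rewrite opprB addrCA subrr addr0 mulrC; congr (_ * _).
  by apply: eq_bigr => i _; rewrite expr1n mul1r.
by rewrite ps1_coefD ps1_coefN ps1_expr_order// subr0.
Qed.

Definition ps1_unit : {pred ps1 R} := [pred u : ps1 R | u 0%N != 0].

Definition ps1_inv u : ps1 R :=
  if u \in ps1_unit then
    ps1C (u 0%N)^-1 * ps1_inv1 (ps1C (u 0%N)^-1 * u) else u.

Fact ps1_mulVx : {in ps1_unit, left_inverse 1 ps1_inv *%R}.
Proof.
move=> u uu; rewrite /ps1_inv uu mulrAC mulrC.
by rewrite ps1_mulV1// ps1_coefCM mulVf.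
Qed.
Fact ps1_unitPl u v : v * u = 1 -> u \in ps1_unit.
Proof.
move=> /ps1P/(_ 0%N); rewrite ps1_coef0M ps1_coef1/= => vu.
by apply/eqP => u0; move/eqP: vu; rewrite u0 mulr0 eq_sym oner_eq0.
Qed.
Fact ps1_inv_out : {in [predC ps1_unit], ps1_inv =1 id}.
Proof. by move=> u /negbTE uu; rewrite /ps1_inv uu. Qed.

HB.instance Definition _ := GRing.ComNzRing_hasMulInverse.Build (ps1 R)
  ps1_mulVx ps1_unitPl ps1_inv_out.

Lemma ps1_unitE u : (u \is a GRing.unit) = (u 0%N != 0).
Proof. by []. Qed.

End FpsRing.

(** * Coefficient bounds and expansions with increasing orders *)

Section Expansion.
Context {R : realType}.
Implicit Types u v w f : ps1 R.

Definition ps1_bounded (M rho : R) f := forall n, cabs (f n) <= M * rho ^+ n.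

(** The constant 4 makes the sum of |u_n| rho^(- n) over n >= 1 at most 1/2: on the
    scale of radius 1/rho, such a u is a perturbation of 1. *)
Definition tame (rho : R) u :=
  u 0%N = 1 /\ forall n, (0 < n)%N -> cabs (u n) <= (rho / 4) ^+ n.

Lemma geo4_le (n : nat) : \sum_(i < n) (4^-1 : R) ^+ i.+1 <= 2^-1.
Proof.
suff -> : \sum_(i < n) (4^-1 : R) ^+ i.+1 = (1 - 4^-1 ^+ n) / 3.
  by have : 0 <= (4^-1 : R) ^+ n by []; lra.
elim: n => [|n IH]; first by rewrite big_ord0 expr0 subrr mul0r.
by rewrite big_ord_recr/= IH exprS; field.
Qed.

Lemma tame_mulB (M rho : R) u f n : 0 < rho -> 0 <= M -> tame rho u ->
  (forall k, (k < n)%N -> cabs (f k) <= M * rho ^+ k) ->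
  cabs ((u * f) n - f n) <= M * rho ^+ n / 2.
Proof.
move=> rho0 M0 [u0 uB] fB.
rewrite ps1_coefM big_ord_recl/= u0 mul1r subn0 addrAC subrr add0r.
apply: (le_trans (cabs_sum _ _ _)).
apply: (@le_trans _ _ (\sum_(i < n) M * rho ^+ n * 4^-1 ^+ i.+1)).
  apply: ler_sum => i _; rewrite cabsM.
  have -> : M * rho ^+ n * 4^-1 ^+ i.+1 =
      (rho / 4) ^+ i.+1 * (M * rho ^+ (n - i.+1)).
    rewrite -{1}(subnK (ltn_ord i)) exprD exprMn; ring.
  apply: ler_pM; rewrite ?cabs_ge0//; first exact: uB.
  by rewrite fB// ltn_subrL/= (leq_trans _ (ltn_ord i)).
rewrite -mulr_sumr; apply: ler_wpM2l; last exact: geo4_le.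
by rewrite mulr_ge0// exprn_ge0// ltW.
Qed.

Lemma ps1_bounded_ge0 M rho f : ps1_bounded M rho f -> 0 <= M.
Proof. by move=> /(_ 0%N); rewrite expr0 mulr1; apply: le_trans; exact: cabs_ge0. Qed.

Lemma ps1_bounded_mul M rho u f : 0 < rho -> tame rho u ->
  ps1_bounded M rho f -> ps1_bounded (M * 2) rho (u * f).
Proof.
move=> rho0 tu fB n; have M0 := ps1_bounded_ge0 fB.
have := tame_mulB rho0 M0 tu (fun k _ => fB k) (n := n); have := fB n.
have := cabsD ((u * f) n - f n) (f n); rewrite subrK.
have : 0 <= M * rho ^+ n by rewrite mulr_ge0// exprn_ge0// ltW.
by rewrite [in X in _ -> _ -> _ -> _ -> X]mulrAC; move: (M * rho ^+ n) => c; lra.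
Qed.

(** Since u f is within half the bound of f, the bound for f follows by strong
    induction on the index. *)
Lemma ps1_bounded_div M rho u f : 0 < rho -> tame rho u ->
  ps1_bounded M rho (u * f) -> ps1_bounded (M * 2) rho f.
Proof.
move=> rho0 tu ufB; have M0 := ps1_bounded_ge0 ufB.
elim/ltn_ind => n IH.
have := @tame_mulB (M * 2) rho u f n rho0 _ tu IH; rewrite mulr_ge0// => /(_ isT).
have := ufB n; have := cabsB ((u * f) n) ((u * f) n - f n).
rewrite opprB addrC subrK; move: (rho ^+ n) => c.
by rewrite (mulrAC M 2 c) mulfK//; lra.
Qed.

Lemma tame_unit rho u : tame rho u -> u \is a GRing.unit.
Proof. by case=> u0 _; rewrite ps1_unitE u0 oner_eq0. Qed.

Lemma ps1_bounded_mulXz M rho u f (e : int) : 0 < rho -> tame rho u ->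
  ps1_bounded M rho f -> ps1_bounded (M * 2 ^+ `|e|%N) rho (u ^ e * f).
Proof.
move=> rho0 tu; have Uu := tame_unit tu.
case: e => n fB /=.
  rewrite -exprnP; elim: n => [|n IH]; first by rewrite !expr0 mulr1 mul1r.
  have -> : M * 2 ^+ n.+1 = M * 2 ^+ n * 2 by rewrite exprSr mulrA.
  have -> : u ^+ n.+1 * f = u * (u ^+ n * f) by rewrite exprS mulrA.
  exact: ps1_bounded_mul.
rewrite [X in ps1_bounded _ _ (X * _)](_ : _ = u ^- n.+1)//=.
move: n.+1 => {}n; elim: n => [|n IH].
  by rewrite !expr0 invr1 mulr1 mul1r.
have -> : M * 2 ^+ n.+1 = M * 2 ^+ n * 2 by rewrite exprSr mulrA.
apply: (@ps1_bounded_div _ _ u) => //.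
by rewrite mulrA exprS invrM// ?unitrX// mulrCA mulrV// mulr1.
Qed.

(** Strip off the leading term a_0 u^(e 0) after multiplying by u^(- e 0), divide
    by x^mu and iterate.  A step multiplies the bound by rho^mu for the shift, and
    by 2^L because the next exponent is at distance at most L. *)
Lemma expansion_coef_le (rho : R) u (mu L : nat) : 0 < rho -> tame rho u ->
  (0 < mu)%N ->
  forall N (a : nat -> Cx R) (e : nat -> int) M f,
  ps1_bounded M rho f ->
  (forall m, `|e m.+1 - e m| <= L)%N ->
  (exists r, f = \sum_(m < N) ps1C (a m) * ps1X ^+ (mu * m) * u ^ (e m)
                 + ps1X ^+ (mu * N) * r) ->
  forall m, (m < N)%N ->
  cabs (a m) <= M * 2 ^+ `|e 0%N|%N * (rho ^+ mu * 2 ^+ L) ^+ m.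
Proof.
move=> rho0 tu mu0.
have Uu := tame_unit tu; case: (tu) => u0 _.
elim=> [//|N IH] a e M f fB eL [r fE] m mN.
pose f1 := u ^ (- e 0%N) * f.
have f1B : ps1_bounded (M * 2 ^+ `|e 0%N|%N) rho f1.
  by rewrite -(abszN (e 0%N)); exact: ps1_bounded_mulXz.
pose g := \sum_(m < N) ps1C (a m.+1) * ps1X ^+ (mu * m) * u ^ (e m.+1 - e 0%N)
          + ps1X ^+ (mu * N) * (u ^ (- e 0%N) * r).
have f1E : f1 = ps1C (a 0%N) + ps1X ^+ mu * g.
  rewrite /f1 fE big_ord_recl/= muln0 expr0 mulr1 /g !mulrDr -addrA.
  congr (_ + (_ + _)).
  - by rewrite mulrCA -exprzDr// addNr mulr1.
  - rewrite !mulr_sumr; apply: eq_bigr => i _.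
    rewrite /bump/= add1n mulnS exprD [e i.+1 - _]addrC exprzDr//.
    by move: (u ^ _) (u ^ _) => v w; ring.
  - by rewrite mulnS exprD; move: (u ^ _) => v; ring.
have gE n : g n = f1 (n + mu)%N.
  rewrite f1E ps1_coefD ps1_coefXnM ltnNge leq_addl addnK /ps1C /ps1_monomial/=.
  by rewrite addn_eq0 (gtn_eqF mu0) andbF add0r.
have gB : ps1_bounded (M * 2 ^+ `|e 0%N|%N * rho ^+ mu) rho g.
  by move=> n; rewrite gE (le_trans (f1B _))// exprD -!mulrA [rho ^+ n * _]mulrC.
case: m mN => [|m] mN.
  rewrite expr0 mulr1; have := f1B 0%N.
  rewrite f1E ps1_coefD ps1_coefXnM mu0 addr0 expr0 mulr1.
  by rewrite /ps1C /ps1_monomial.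
have eL' i : (`|((e i.+2 - e 0%N) - (e i.+1 - e 0%N))%R| <= L)%N.
  by rewrite opprB addrA subrK.
have gex : exists r0, g = \sum_(m < N) ps1C (a m.+1) * ps1X ^+ (mu * m)
    * u ^ (e m.+1 - e 0%N) + ps1X ^+ (mu * N) * r0 by eexists; reflexivity.
have := IH (fun i => a i.+1) (fun i => e i.+1 - e 0%N) _ g gB eL' gex m mN.
move=> /le_trans; apply; rewrite exprS !mulrA.
apply: ler_wpM2r; first by rewrite exprn_ge0// mulr_ge0// exprn_ge0// ltW.
apply: ler_wpM2l; first exact: ps1_bounded_ge0 gB.
by rewrite ler_weXn2l// ler1n.
Qed.

End Expansion.

(** * Recovering the double series from its lines *)

Section Lines.
Context {R : realType}.
Implicit Types u v w f h : ps1 R.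

Lemma tame_le rho rho' u : 0 <= rho -> rho <= rho' -> tame rho u -> tame rho' u.
Proof.
move=> rho0 le_rho [u0 uB]; split=> // n n0; apply: (le_trans (uB n n0)).
apply: lerXn2r; rewrite ?nnegrE; lra.
Qed.

(** Every convergent f <> 0 is c x^k u with u tame: k is the order of f, and the
    radius is shrunk until the tail of u is small. *)
Lemma ps1_factor f : (exists n, f n != 0) -> ps1_convergent f ->
  exists c k u rho, [/\ f = ps1C c * ps1X ^+ k * u, c != 0, 1 <= rho & tame rho u]
    /\ (f 0%N = 0 -> (0 < k)%N).
Proof.
move=> fn0 [C fC]; have [k fk kmin] := ex_minnP fn0.
pose c := f k; pose u : ps1 R := ps1C c^-1 * ps1_shift k f.
have cn0 : cabs c != 0 by rewrite cabs_eq0.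
pose D := Num.max 1 `|C|; have D1 : 1 <= D by rewrite le_max lexx.
have fD n : (0 < n)%N -> cabs (f n) <= D ^+ n.
  move=> n0; apply: le_trans (fC n _) _; first by rewrite -lt0n.
  rewrite (le_trans (ler_norm _))// normrX lerXn2r ?nnegrE//; first lra.
  by rewrite /D le_max lexx orbT.
pose E := Num.max 1 (cabs c)^-1; have E1 : 1 <= E by rewrite le_max lexx.
have DE1 : 1 <= D ^+ k.+1 * E by rewrite mulr_ege1// exprn_ege1.
exists c, k, u, (4 * (D ^+ k.+1 * E)); split; first split=> //.
- rewrite /u mulrACA -rmorphM mulfV// rmorph1 mul1r.
  rewrite ps1_shiftK// => n nk; apply/eqP; apply: contraLR nk => /kmin.
  by rewrite -leqNgt.
- lra.
- split; first by rewrite /u ps1_coefCM /ps1_shift add0n mulVf.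
  move=> n n0; rewrite [4 * _]mulrC mulfK// /u ps1_coefCM cabsM cabsV /ps1_shift.
  have DE : D ^+ (n + k) * E <= (D ^+ k.+1 * E) ^+ n.
    rewrite exprMn -exprM; apply: ler_pM; rewrite ?exprn_ge0//; try lra.
      by apply: ler_weXn2l => //; nia.
    by rewrite -[leLHS]expr1; apply: ler_weXn2l.
  apply: le_trans DE; rewrite mulrC; apply: ler_pM; rewrite ?invr_ge0 ?cabs_ge0//.
    by rewrite fD// addn_gt0 n0.
  by rewrite /E le_max lexx orbT.
- by move=> f0; rewrite lt0n; apply: contraNN fk => /eqP->; rewrite f0.
Qed.

Definition line_part (g : ps2 R) (sigma tau p : int) : ps2 R :=
  fun i j => if sigma * i%:Z + tau * j%:Z == p then g i j else 0.

Lemma ps2_subst_X (g : ps2 R) h n N : h 0%N = 0 -> (n <= N)%N ->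
  ps2_subst g ps1X h n = \sum_(i < N.+1) \sum_(j < N.+1)
    g i j * (ps1X ^+ i * h ^+ j) n.
Proof.
move=> h0 nN; rewrite (@ps2_subst_trunc _ _ _ _ _ _ _ N)//.
by apply: eq_bigr => i _; apply: eq_bigr => j _; rewrite !ps1_expE.
Qed.

Lemma ps2_convergent_geo (g : ps2 R) (M C : R) : 1 <= M -> 0 <= C ->
  (forall i j, cabs (g i j) <= M * C ^+ (i + j)) -> ps2_convergent g.
Proof.
move=> M1 C0 gB; exists (M * C) => i j ij; apply: (le_trans (gB i j)).
have : (0 < i + j)%N.
  by rewrite lt0n addn_eq0; apply: contraNN ij => /andP[/eqP-> /eqP->].
case: (i + j)%N => // m _; rewrite exprMn; apply: ler_wpM2r; first exact: exprn_ge0.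
by rewrite -[leLHS]expr1; apply: ler_weXn2l.
Qed.

Lemma divz_dist_le (a b d : int) : d != 0 ->
  (`|((a %/ d)%Z - (b %/ d)%Z)%R| <= `|(a - b)%R| + 1)%N.
Proof.
move=> d0; have := divz_eq a d; have := divz_eq b d.
have := modz_ge0 a d0; have := modz_ge0 b d0.
have := ltz_mod a d0; have := ltz_mod b d0.
move: (a %/ d)%Z (b %/ d)%Z (a %% d)%Z (b %% d)%Z => qa qb ra rb.
move=> rbd rad rb0 ra0 bE aE; rewrite {}aE {}bE.
nia.
Qed.

(** For h = b x^k u, the hypothesis GB is the bound on the series G_p, uniform
    in p. *)
Section Substitution.
Variables (g : ps2 R) (h u : ps1 R) (b : Cx R) (k : nat) (sigma tau : int).
Variables (rho M : R).
Hypotheses (hE : h = ps1C b * ps1X ^+ k * u) (b0 : b != 0) (k0 : (0 < k)%N).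
Hypotheses (rho1 : 1 <= rho) (tu : tame rho u) (M1 : 1 <= M).
Hypothesis GB : forall p,
  ps1_bounded M rho (ps2_subst (line_part g sigma tau p) ps1X h).

Let h0 : h 0%N = 0.
Proof. by rewrite hE mulrAC mulrC ps1_coefXnM k0. Qed.

Let XhE i j : ps1X ^+ i * h ^+ j = ps1C (b ^+ j) * ps1X ^+ (i + k * j) * u ^+ j.
Proof. by rewrite hE !exprMn -exprM exprD rmorphXn/=; ring. Qed.

Lemma convergent_of_scaled_bound (C : R) : 1 <= C ->
  (forall i j, cabs (g i j * b ^+ j) <= M * C ^+ (i + j)) -> ps2_convergent g.
Proof.
move=> C1 gB; pose E := Num.max 1 (cabs b)^-1.
have E1 : 1 <= E by rewrite le_max lexx.
apply: (@ps2_convergent_geo _ M (C * E)) => //; first by rewrite mulr_ge0// (le_trans ler01).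
move=> i j; rewrite exprMn mulrA.
have -> : cabs (g i j) = cabs (g i j * b ^+ j) * (cabs b)^-1 ^+ j.
  by rewrite cabsM cabsX -mulrA -exprMn mulfV ?cabs_eq0// expr1n mulr1.
apply: ler_pM; rewrite ?cabs_ge0 ?exprn_ge0 ?invr_ge0 ?cabs_ge0//.
apply: (@le_trans _ _ (E ^+ j)); last by apply: ler_weXn2l => //; rewrite leq_addl.
rewrite lerXn2r ?nnegrE ?invr_ge0 ?cabs_ge0 ?(le_trans ler01)//.
by rewrite le_max lexx orbT.
Qed.

(** On the line sigma i + tau j = p, a point is determined by the order
    m = i + k j, with delta j = p - sigma m for delta = tau - sigma k.  The line
    is thus an expansion with orders m and exponents of u given by
    floor((p - sigma m) / delta), which vary by a bounded amount; the m for which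
    the division is not exact carry the coefficient 0. *)
Lemma convergent_transversal : tau - sigma * k%:Z != 0 -> ps2_convergent g.
Proof.
set delta := tau - sigma * k%:Z => delta0.
have rho0 : 0 < rho := lt_le_trans ltr01 rho1.
pose L := (`|sigma| + 1)%N; pose T := (`|sigma| + `|tau| + 1)%N.
pose C := 2 ^+ T * (rho * 2 ^+ L) ^+ k.
have D1 : 1 <= rho * 2 ^+ L by rewrite mulr_ege1// exprn_ege1// ler1n.
have C1 : 1 <= C by rewrite mulr_ege1// exprn_ege1// ler1n.
apply: (convergent_of_scaled_bound C1) => i0 j0.
pose p := sigma * i0%:Z + tau * j0%:Z; pose N := (i0 + k * j0).+1.
pose a m := \sum_(i < N) \sum_(j < N)
  if (i + k * j == m)%N then line_part g sigma tau p i j * b ^+ j else 0.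
pose e (m : nat) : int := ((p - sigma * m%:Z) %/ delta)%Z.
have eE i j : sigma * i%:Z + tau * j%:Z = p -> e (i + k * j)%N = j.
  move=> ijp; rewrite /e -ijp PoszD PoszM.
  have -> : sigma * i%:Z + tau * j%:Z - sigma * (i%:Z + k%:Z * j%:Z) = delta * j%:Z.
    by rewrite /delta; ring.
  by rewrite mulKz.
have eL m : (`|(e m.+1 - e m)%R| <= L)%N.
  apply: (leq_trans (divz_dist_le _ _ delta0)); rewrite leq_add2r -addn1 PoszD.
  by rewrite (_ : _ - _ = - sigma) ?abszN//; ring.
have e0 : (`|e 0%N| <= T * (i0 + j0))%N.
  rewrite /e mulr0 subr0; have [p0|p0] := eqVneq p 0; first by rewrite p0 div0z.
  have ij0 : (0 < i0 + j0)%N by move: p0; rewrite /p; nia.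
  have := divz_dist_le p 0 delta0; rewrite div0z !subr0 => /leq_trans; apply.
  by rewrite /p /T; nia.
have aE : a (i0 + k * j0)%N = g i0 j0 * b ^+ j0.
  have i0N : (i0 < N)%N by rewrite ltnS leq_addr.
  have j0N : (j0 < N)%N by rewrite ltnS (leq_trans (leq_pmull j0 k0))// leq_addl.
  rewrite /a (bigD1 (Ordinal i0N))//= (bigD1 (Ordinal j0N))//= eqxx.
  rewrite {1}/line_part eqxx big1 => [|j jj0]; last first.
    rewrite eqn_add2l eqn_pmul2l//; case: eqP => // jE.
    by move/eqP: jj0; case; apply: val_inj.
  rewrite addr0 big1 ?addr0// => i ii0; rewrite big1// => j _.
  case: eqP => // ijm; rewrite /line_part; case: eqP => [ijp|]; last by rewrite mul0r.
  have jE : (j : nat) = j0.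
    by apply/eqP; rewrite -eqz_nat -(eE _ _ ijp) ijm (eE i0 j0).
  by move/eqP: ii0; case; apply: val_inj => /=; move: ijm; rewrite jE => /addIn.
have exr : exists r, ps2_subst (line_part g sigma tau p) ps1X h =
    \sum_(m < N) ps1C (a m) * ps1X ^+ (1 * m) * u ^ (e m) + ps1X ^+ (1 * N) * r.
  set f := ps2_subst _ _ _; set S := \sum_(m < N) _.
  exists (ps1_shift N (f - S)); rewrite mul1n ps1_shiftK; first by rewrite addrC subrK.
  move=> n nN; rewrite ps1_coefD ps1_coefN; apply/eqP; rewrite subr_eq0; apply/eqP.
  rewrite /f (ps2_subst_X _ h0 (_ : n <= N.-1)%N)// prednK// /S ps1_coef_sum.
  transitivity (\sum_(m < N) \sum_(i < N) \sum_(j < N)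
     if (i + k * j == m)%N then
       line_part g sigma tau p i j * b ^+ j * (ps1X ^+ (i + k * j) * u ^+ j) n else 0).
    rewrite [RHS]exchange_big; apply: eq_bigr => i _.
    rewrite [RHS]exchange_big; apply: eq_bigr => j _.
    rewrite XhE -mulrA ps1_coefCM mulrA.
    (* The points with i + k j >= N have order at least N and do not reach x^n. *)
    case: (ltnP (i + k * j) N) => ijN.
      rewrite (bigD1 (Ordinal ijN))//= eqxx big1 ?addr0// => m mN.
      by case: eqP => // mE; move/eqP: mN; case; apply: val_inj.
    rewrite ps1_coefXnM (leq_trans nN)// mulr0 big1// => m _.
    by case: eqP => // mE; move: ijN; rewrite mE leqNgt ltn_ord.
  apply: eq_bigr => m _; rewrite mul1n -mulrA ps1_coefCM /a mulr_suml.
  apply: eq_bigr => i _; rewrite mulr_suml; apply: eq_bigr => j _.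
  case: eqP => [ijm|]; last by rewrite mul0r.
  rewrite /line_part; case: eqP => [ijp|]; last by rewrite !mul0r.
  by rewrite -ijm (eE _ _ ijp).
have := expansion_coef_le rho0 tu (ltn0Sn 0) (GB p) eL exr (ltnSn (i0 + k * j0)).
rewrite aE => /le_trans; apply; rewrite expr1 -mulrA; apply: ler_wpM2l; first exact: le_trans ler01 M1.
have D0 : 0 <= rho * 2 ^+ L := le_trans ler01 D1.
rewrite /C [leRHS]exprMn -!exprM; apply: ler_pM; rewrite ?exprn_ge0//.
  by apply: ler_weXn2l => //; rewrite ler1n.
by apply: ler_weXn2l => //; nia.
Qed.

(** On the line i + k j = q the products x^i h^j all have order q, so they are
    told apart by u only: the line is x^q P(u) for a polynomial P, which is
    re-expanded as Q(w) with w = u - 1 and Q = P(X + 1).  The powers of w do have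
    increasing orders. *)
Lemma convergent_tangent : tau = sigma * k%:Z -> sigma != 0 -> u != 1 ->
  ps2_convergent g.
Proof.
move=> tauE sigma0 u1; have rho0 : 0 < rho := lt_le_trans ltr01 rho1.
case: (tu) => u0 uB; pose w := u - 1.
have [c [e [v [rho' [[wE c0 rho'1 tv] e0]]]]] : exists c e v rho',
    [/\ w = ps1C c * ps1X ^+ e * v, c != 0, 1 <= rho' & tame rho' v]
    /\ (w 0%N = 0 -> (0 < e)%N).
  apply: ps1_factor.
    apply: contrapT => w0; move/eqP: u1; apply; apply/eqP; rewrite -subr_eq0.
    apply/eqP/ps1P => n; apply/eqP; apply: contrapT => /negP wn.
    by apply: w0; exists n.
  exists (rho / 4) => -[//|n] _.
  by rewrite /w ps1_coefD ps1_coefN ps1_coef1 subr0 uB.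
have {}e0 : (0 < e)%N.
  by apply: e0; rewrite /w ps1_coefD ps1_coefN u0 ps1_coef1 subrr.
pose r := Num.max rho rho'.
have r1 : 1 <= r by rewrite le_max rho1.
have r0 : 0 < r := lt_le_trans ltr01 r1.
have tvr : tame r v.
  by apply: tame_le tv; rewrite ?(le_trans ler01)// le_max lexx orbT.
pose kap := Num.max 1 (r ^+ e * 2 / cabs c).
have kap1 : 1 <= kap by rewrite le_max lexx.
pose D := 2 * r * (kap * 2).
have D1 : 1 <= D.
  by rewrite /D !mulr_ege1// ler1n.
apply: (@convergent_of_scaled_bound (D ^+ k)) => [|i0 j0]; first exact: exprn_ege1.
pose q := (i0 + k * j0)%N.
pose gam j := if (k * j <= q)%N then g (q - k * j)%N j * b ^+ j else 0.
pose P := \poly_(j < q.+1) gam j.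
pose S := (map_poly ps1C P).[u].
have gamq j : (q < j)%N -> gam j = 0.
  move=> qj; rewrite /gam leqNgt (leq_trans qj)//; exact: leq_pmull.
have SP : S = \sum_(j < q.+1) ps1C (gam j) * u ^+ j.
  rewrite /S (@horner_coef_wide _ q.+1); last first.
    by rewrite (leq_trans (size_poly _ _))// size_poly.
  by apply: eq_bigr => j _; rewrite coef_map coef_poly ltn_ord.
have SE : ps2_subst (line_part g sigma tau (sigma * q%:Z)) ps1X h = ps1X ^+ q * S.
  apply/ps1P => n; rewrite (ps2_subst_X _ h0 (leq_addr q n)) exchange_big/=.
  rewrite SP mulr_sumr ps1_coef_sum.
  have qnq : (q.+1 <= (n + q).+1)%N by rewrite ltnS leq_addl.
  rewrite (big_ord_widen _ (fun j => (ps1X ^+ q * (ps1C (gam j) * u ^+ j)) n) qnq).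
  rewrite [RHS]big_mkcond/=; apply: eq_bigr => j _.
  have condE i : (sigma * i%:Z + tau * (j : nat)%:Z == sigma * q%:Z) = (i + k * j == q)%N.
    rewrite tauE -mulrA -mulrDr -PoszM -PoszD (inj_eq (mulfI sigma0)).
    by rewrite eqz_nat.
  under eq_bigr do rewrite /line_part condE.
  transitivity (gam j * (ps1X ^+ q * u ^+ j) n); last first.
    rewrite mulrCA ps1_coefCM; case: ltnP => // /gamq ->.
    by rewrite mul0r.
  rewrite /gam; case: (leqP (k * j) q) => kjq; last first.
    rewrite mul0r big1// => i _; case: eqP => [ijq|]; last by rewrite mul0r.
    by have := leq_addl i (k * j)%N; rewrite ijq leqNgt kjq.
  have iN : (q - k * j < (n + q).+1)%N.
    by rewrite ltnS (leq_trans (leq_subr _ _))// leq_addl.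
  rewrite (bigD1 (Ordinal iN))//= subnK// eqxx XhE subnK// -mulrA ps1_coefCM mulrA.
  rewrite big1 ?addr0// => i iq; case: eqP => [ijq|]; last by rewrite mul0r.
  move/eqP: iq; case; apply: val_inj => /=; apply/eqP.
  by rewrite -(eqn_add2r (k * j)) subnK// ijq.
have SB : ps1_bounded (M * r ^+ q) r S.
  move=> n; have := GB (sigma * q%:Z) (n + q)%N; rewrite SE ps1_coefXnM.
  rewrite ltnNge leq_addl addnK => /le_trans; apply.
  rewrite -mulrA -exprD [(q + n)%N]addnC; apply: ler_wpM2l; first exact: le_trans ler01 M1.
  by rewrite lerXn2r ?nnegrE ?(le_trans ler01)// le_max lexx.
pose Q := P \Po ('X + 1).
have sQ : (size Q <= q.+1)%N.
  apply: leq_trans (size_comp_poly_leq _ _) _.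
  have := size_poly q.+1 gam; rewrite -/P -polyC1 size_XaddC muln1.
  by case: (size P).
have SQ : S = \sum_(l < q.+1) ps1C (Q`_l * c ^+ l) * ps1X ^+ (e * l) * v ^ l%:Z.
  have -> : S = (map_poly ps1C Q).[w].
    rewrite /Q map_comp_poly horner_comp rmorphD/= map_polyX rmorph1.
    by rewrite hornerD hornerX hornerC /w subrK.
  rewrite (@horner_coef_wide _ q.+1); last by rewrite (leq_trans (size_poly _ _)).
  apply: eq_bigr => l _; rewrite coef_map/= wE -exprnP !exprMn -exprM rmorphM rmorphXn/=.
  by rewrite !mulrA.
have QB l : (l < q.+1)%N -> cabs Q`_l <= M * r ^+ q * kap ^+ q.
  move=> lq; have := @expansion_coef_le _ r v e 1 r0 tvr e0 q.+1 (fun l => Q`_l * c ^+ l)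
    (fun l => l%:Z) _ S SB _ _ l lq.
  rewrite expr0 mulr1 expr1 cabsM cabsX -ler_pdivlMr ?exprn_gt0 ?cabs_gt0// => H.
  apply: le_trans (H _ _) _.
  - by move=> m; rewrite -addn1 PoszD addrAC subrr add0r.
  - by exists 0; rewrite mulr0 addr0.
  rewrite -[leLHS]mulrA -expr_div_n; apply: ler_wpM2l.
    by rewrite mulr_ge0 ?exprn_ge0 ?(le_trans ler01).
  apply: (@le_trans _ _ (kap ^+ l)); last by rewrite ler_weXn2l.
  rewrite lerXn2r ?nnegrE ?divr_ge0 ?cabs_ge0 ?mulr_ge0 ?exprn_ge0//
    ?(le_trans ler01 r1) ?(le_trans ler01 kap1)//.
  by rewrite /kap le_max lexx orbT.
have -> : g i0 j0 * b ^+ j0 = P`_j0.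
  rewrite coef_poly ltnS /q (leq_trans (leq_pmull j0 k0)) ?leq_addl//.
  by rewrite /gam leq_addl addnK.
(* Undo the translation: the coefficients of (X - 1)^l are at most 2^l. *)
have -> : P = Q \Po ('X - 1).
  by rewrite /Q -comp_polyA comp_polyD comp_polyX -polyC1 comp_polyC subrK comp_polyXr.
rewrite coef_comp_poly; apply: (le_trans (cabs_sum _ _ _)).
have MB : 0 <= M * r ^+ q * kap ^+ q.
  by rewrite !mulr_ge0 ?exprn_ge0 ?(le_trans ler01).
apply: (@le_trans _ _ (\sum_(l < size Q) M * r ^+ q * kap ^+ q * 2 ^+ q)).
  apply: ler_sum => l _; have lq := leq_trans (ltn_ord l) sQ.
  rewrite cabsM; apply: ler_pM; rewrite ?cabs_ge0//; first exact: QB.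
  have -> : ('X - 1 : {poly Cx R}) ^+ l = \prod_(z <- nseq l 1) ('X - z%:P).
    by rewrite big_nseq polyC1 iter_mulr_1.
  apply: (le_trans (poly_prod_coef_le _ _)).
  rewrite big_nseq cabs1 iter_mulr_1; apply: ler_weXn2l; first by rewrite lerDl ler01.
  by rewrite -ltnS.
rewrite sumr_const card_ord -[leLHS]mulr_natl.
apply: (@le_trans _ _ (M * D ^+ q)); last first.
  apply: ler_wpM2l; first exact: le_trans ler01 M1.
  by rewrite -exprM; apply: ler_weXn2l => //; rewrite /q; nia.
have -> : M * D ^+ q = 2 ^+ q * (M * r ^+ q * kap ^+ q * 2 ^+ q).
  by rewrite /D !exprMn; ring.
apply: ler_wpM2r; first by rewrite mulr_ge0// exprn_ge0.
by rewrite -natrX ler_nat (leq_trans sQ)// ltn_expl.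
Qed.

End Substitution.
End Lines.

(** * The logarithmic kernel *)

Section LogKernel.
Context {R : realType}.
Implicit Types (z w : Cx R) (p : {poly Cx R}) (r : R).

Lemma horner_continuous p : continuous (fun z : Cx R => p.[z]).
Proof.
elim/poly_ind: p => [|p c IH] z.
  by rewrite (_ : (fun _ => _) = cst 0); [exact: cst_continuous|apply/funext => w; rewrite horner0].
rewrite (_ : (fun _ => _) = (fun w : Cx R => p.[w] * w + c)); last first.
  by apply/funext => w; rewrite hornerMXaddC.
apply: (@continuousD _ _ _ (fun w : Cx R => p.[w] * w) (cst c)).
  by apply: (@continuousM _ _ (fun w => p.[w]) id); [exact: IH|move=> A].
exact: cst_continuous.
Qed.

Lemma open_cabs_gt (x : R) : open [set z : Cx R | x < cabs z].
Proof.
rewrite openE => z /= xz; apply/nbhs_ballP; exists (cabs z - x)%:C%C => /=.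
  by rewrite ltcR subr_gt0.
move=> w; rewrite /ball/= normr_cabs ltcR => zw /=.
by have := cabsD w (z - w); rewrite addrC subrK; lra.
Qed.

Lemma open_cabs_horner_gt p (x : R) : open [set z : Cx R | x < cabs p.[z]].
Proof.
apply: (@open_comp _ _ (fun z : Cx R => p.[z]) [set z | x < cabs z]).
  by move=> z _; exact: horner_continuous.
exact: open_cabs_gt.
Qed.

Lemma open_measurable (A : set (Cx R)) : open A -> measurable (A : set (@borelCx R)).
Proof. exact: sub_sigma_algebra. Qed.

Lemma measurable_cabs_horner p :
  measurable_fun setT (fun z : @borelCx R => cabs p.[z]).
Proof.
move=> mD; apply: (measurability _ (RGenOInfty.measurableE R)) => //=.
move=> _ -[_ [x ->] <-]; rewrite setTI; apply: open_measurable.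
rewrite (_ : _ @^-1` _ = [set z | x < cabs p.[z]]); first exact: open_cabs_horner_gt.
by apply/seteqP; split=> z /=; rewrite in_itv/= andbT.
Qed.

Lemma measurable_cabs_sub w : measurable_fun setT (fun z : @borelCx R => cabs (w - z)).
Proof.
rewrite (_ : (fun _ => _) = (fun z => cabs ('X - w%:P).[z])).
  exact: measurable_cabs_horner.
by apply/funext => z; rewrite !hornerE cabs_distC.
Qed.

Lemma measurable_lne_EFin : measurable_fun setT (fun x : R => lne x%:E).
Proof.
rewrite /lne; apply: measurable_fun_ifT => //=.
- by apply: measurable_fun_ler => //; exact: measurable_cst.
- by apply/measurable_EFinP; exact: measurable_ln.
Qed.

Lemma measurable_nlog w :
  measurable_fun setT (fun z : @borelCx R => (- lne (cabs (w - z))%:E)%E).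
Proof.
apply: measurableT_comp => //.
by apply: (measurableT_comp measurable_lne_EFin); exact: measurable_cabs_sub.
Qed.

Definition closed_disc r : set (@borelCx R) := [set z | cabs z <= r].

Lemma measurable_closed_disc r : measurable (closed_disc r).
Proof.
rewrite (_ : closed_disc r = ~` [set z | r < cabs z]); last first.
  by apply/seteqP; split=> z /= => [zr|/negP]; [apply/negP|]; rewrite -leNgt.
by apply: measurableC; apply: open_measurable; exact: open_cabs_gt.
Qed.


(** The value at z is log (r (1 + |w|) / |w - z|).  For |z| <= r and 1 <= r, the
    numerator makes it nonnegative, and bounded as w tends to infinity. *)
Definition log_kernel r w z : \bar R :=
  ((ln (r * (1 + cabs w)))%:E + - lne (cabs (w - z))%:E)%E.

Lemma measurable_log_kernel r w :
  measurable_fun setT (log_kernel r w : @borelCx R -> \bar R).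
Proof. by apply: emeasurable_funD; [exact: measurable_cst|exact: measurable_nlog]. Qed.

Lemma log_kernel_eq r w : log_kernel r w w = +oo%E.
Proof. by rewrite /log_kernel subrr cabs0 le0_lneNy. Qed.

Lemma log_kernel_neq r w z : 0 < r -> z != w ->
  log_kernel r w z = (ln (r * (1 + cabs w) / cabs (w - z)))%:E.
Proof.
move=> r0 zw; have wz : 0 < cabs (w - z) by rewrite cabs_gt0 subr_eq0 eq_sym.
have rw : 0 < r * (1 + cabs w) by rewrite mulr_gt0// ltr_wpDr// cabs_ge0.
by rewrite /log_kernel lne_EFin// ln_div ?posrE.
Qed.

Lemma log_kernel_ge0 r w z : 1 <= r -> cabs z <= r -> (0 <= log_kernel r w z)%E.
Proof.
move=> r1 zr; have r0 : 0 < r := lt_le_trans ltr01 r1.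
have [->|zw] := eqVneq z w; first by rewrite log_kernel_eq.
rewrite log_kernel_neq// lee_fin ln_ge0// ler_pdivlMr ?cabs_gt0; last first.
  by rewrite subr_eq0 eq_sym.
by rewrite mul1r (le_trans (cabsB _ _))//; have := cabs_ge0 w; nra.
Qed.

Lemma log_kernel_far r w z : 1 <= r -> cabs z <= r -> 2 * r <= cabs w ->
  (log_kernel r w z <= (ln (4 * r))%:E)%E.
Proof.
move=> r1 zr wr; have r0 : 0 < r := lt_le_trans ltr01 r1.
have zw : z != w by apply: contraTneq wr => <-; rewrite -ltNge; lra.
have wz : 0 < cabs (w - z) by rewrite cabs_gt0 subr_eq0 eq_sym.
have rw : 0 < r * (1 + cabs w) by rewrite mulr_gt0// ltr_wpDr// cabs_ge0.
rewrite log_kernel_neq// lee_fin ler_ln ?posrE ?divr_gt0// ?mulr_gt0//.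
rewrite ler_pdivrMr// [4 * r]mulrC -mulrA ler_pM2l//.
by have := cabsD (w - z) z; rewrite subrK; lra.
Qed.

(** The logarithm of the product is taken factor by factor, so that a root equal
    to z is absorbed by the value +oo of the kernel. *)
Lemma prod_le_sum_log_kernel r z (s : seq (Cx R)) (c : R) :
  1 <= r -> cabs z <= r -> 0 < c ->
  c * \prod_(w <- s) cabs (w - z) <= \prod_(w <- s) (r * (1 + cabs w)) ->
  ((ln c)%:E <= \sum_(w <- s) log_kernel r w z)%E.
Proof.
move=> r1 zr; have r0 : 0 < r := lt_le_trans ltr01 r1.
elim: s c => [|w s IH] c c0.
  by rewrite !big_nil mulr1 lee_fin => /ln_le0.
rewrite !big_cons; have [zw _|zw] := eqVneq z w.
  rewrite -zw log_kernel_eq addye ?leey// gt_eqF// (lt_le_trans ltNy0)//.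
  by apply: sume_ge0 => v _; exact: log_kernel_ge0.
have wz : 0 < cabs (w - z) by rewrite cabs_gt0 subr_eq0 eq_sym.
have rw : 0 < r * (1 + cabs w) by rewrite mulr_gt0// ltr_wpDr// cabs_ge0.
have q0 : 0 < r * (1 + cabs w) / cabs (w - z) by rewrite divr_gt0.
move=> H; rewrite log_kernel_neq//.
have := IH (c / (r * (1 + cabs w) / cabs (w - z))).
rewrite divr_gt0// => /(_ isT).
rewrite ln_div ?posrE// EFinB leeBlDl// => ->//.
rewrite invf_div mulrA mulrAC ler_pdivrMr// [leRHS]mulrC.
by apply: le_trans H; rewrite -!mulrA.
Qed.

End LogKernel.

(** * Polynomials bounded on a set of positive measure *)

Section Averaging.
Context {R : realType}.
Implicit Types (z w : Cx R) (p : {poly Cx R}) (r : R).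

(** Let p = a prod (X - w).  If the Mahler-type quantity |a| prod (1 + |w|) exceeded
    A B^n, n the number of roots, then at every point of K the sum of the kernels of
    the roots would be at least n log B.  Its integral over K is at most n M, which
    is absurd for log B = (M + 1) / mu(K).  That quantity dominates every
    coefficient of p. *)
Lemma coef_le_of_bounded_kernel (mu : probability (@borelCx R) R)
    (K : set (@borelCx R)) r (M : R) :
  1 <= r -> measurable K -> K `<=` closed_disc r -> (0 < mu K)%E ->
  (forall w, \int[mu]_(z in K) log_kernel r w z <= M%:E)%E ->
  exists2 B, 1 <= B & forall p d A, (size p <= d.+1)%N ->
    (forall z, K z -> cabs p.[z] <= A) -> forall l, cabs p`_l <= A * B ^+ d.
Proof.
move=> r1 mK Kr muK0 MF.
have [kap muKE] : exists kap, mu K = kap%:E.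
  by exists (fine (mu K)); rewrite fineK// fin_num_measure.
have kap0 : 0 < kap by rewrite -lte_fin -muKE.
have M0 : 0 <= M.
  rewrite -lee_fin; apply: le_trans (MF 0); apply: integral_ge0 => z Kz.
  by apply: log_kernel_ge0 => //; exact: Kr.
have [z0 Kz0] : exists z, K z.
  apply/set0P/eqP => K0; move: muK0; by rewrite K0 measure0 ltxx.
pose B := expR ((M + 1) / kap).
have B1 : 1 <= B by rewrite -expR0 ler_expR divr_ge0//; lra.
exists B => // p d A sp pA l.
have A0 : 0 <= A by apply: le_trans (pA _ Kz0); exact: cabs_ge0.
have [->|p0] := eqVneq p 0.
  by rewrite coef0 cabs0 mulr_ge0// exprn_ge0// (le_trans ler01).
have [s pE] := closed_field_poly_normal p; set a := lead_coef p in pE.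
have a0 : a != 0 by rewrite lead_coef_eq0.
have aC : 0 < cabs a by rewrite cabs_gt0.
have sd : (size s <= d)%N.
  by move: sp; rewrite pE size_scale// size_prod_XsubC.
have pz z : cabs p.[z] = cabs a * \prod_(w <- s) cabs (w - z).
  rewrite pE hornerZ cabsM horner_prod cabs_prod; congr (_ * _).
  by apply: eq_bigr => w _; rewrite !hornerE cabs_distC.
apply: (@le_trans _ _ (cabs a * \prod_(w <- s) (1 + cabs w))).
  by rewrite {1}pE coefZ cabsM ler_wpM2l ?cabs_ge0// poly_prod_coef_le.
apply: (@le_trans _ _ (A * B ^+ size s)); last first.
  by rewrite ler_wpM2l// ler_weXn2l.
rewrite leNgt; apply/negP => ABs.
have s0 : (0 < size s)%N.
  rewrite lt0n; apply/eqP => /size0nil s0; move: ABs (pA _ Kz0).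
  by rewrite pz s0 !big_nil expr0 !mulr1 => /lt_geF ->.
have : ((ln (B ^+ size s))%:E * mu K <= (M *+ size s)%:E)%E.
  rewrite -integral_cst//.
  apply: (@le_trans _ _ (\int[mu]_(z in K) \sum_(w <- s) log_kernel r w z)%E).
    apply: ge0_le_integral => //.
    - by move=> z _; rewrite lee_fin ln_ge0// exprn_ege1.
    - apply: emeasurable_sum => w; apply: measurable_funTS.
      exact: measurable_log_kernel.
    - move=> z Kz; apply: prod_le_sum_log_kernel => //; first exact: Kr.
        by rewrite exprn_gt0// (lt_le_trans ltr01).
      rewrite -(ler_pM2l aC) mulrCA -pz.
      apply: (@le_trans _ _ (A * B ^+ size s)).
        rewrite mulrC ler_wpM2r ?pA// exprn_ge0// (le_trans ler01)//.
      apply: (le_trans (ltW ABs)); rewrite ler_wpM2l ?cabs_ge0//.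
      rewrite [leRHS]big_split/=; rewrite -[leLHS]mul1r; apply: ler_wpM2r.
        by rewrite prodr_ge0// => w _; rewrite addr_ge0// cabs_ge0.
      by rewrite big_const_seq iter_mulr_1 exprn_ege1.
  rewrite ge0_integral_sum//; last 2 first.
  - by move=> w; apply: measurable_funTS; exact: measurable_log_kernel.
  - by move=> w z Kz; apply: log_kernel_ge0 => //; exact: Kr.
  have -> : (M *+ size s)%:E = (\sum_(w <- s) M%:E)%E.
    by rewrite sumEFin big_const_seq count_predT iter_addr_0.
  by apply: lee_sum.
rewrite muKE -EFinM lee_fin lnXn ?expR_gt0// expRK mulrnAl divfK ?gt_eqF//.
rewrite ler_pMn2r//; lra.
Qed.

End Averaging.

(** * Measures of bounded potential and positive capacity *)

Section Potential.
Context {R : realType}.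
Implicit Types (z w : Cx R) (p : {poly Cx R}) (r : R).

Lemma cvg_mine_nat (x : \bar R) : (-oo < x)%E ->
  mine n%:R%:E x @[n --> \oo] --> x.
Proof.
case: x => [x _| _|//].
  apply: cvg_near_cst; near=> n.
  by rewrite /mine lte_fin ltNge; have -> : x <= n%:R by near: n; exact: nbhs_infty_ger.
have -> : (fun n => mine n%:R%:E (+oo : \bar R)%E) = (fun n => n%:R%:E).
  by apply/funext => n; rewrite /mine ltry.
by apply/cvgeryP/cvgrnyP; exact: cvg_id.
Unshelve. all: by end_near. Qed.

(** For |w| < 2 r the kernel is -log|w - z| plus a bounded constant, and monotone
    convergence compares its integral with the potential; for |w| >= 2 r the kernel
    itself is at most log(4 r). *)
Lemma log_kernel_integral_le (mu : probability (@borelCx R) R) r (M0 : R) :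
  1 <= r -> (mu (closed_disc r) = 1)%E ->
  (forall z, log_potential mu z <= M0%:E)%E ->
  exists M : R, forall w, (\int[mu]_(z in closed_disc r) log_kernel r w z <= M%:E)%E.
Proof.
move=> r1 mur potB; have r0 : 0 < r := lt_le_trans ltr01 r1.
have mD := @measurable_closed_disc R r.
exists (Num.max (ln (4 * r)) (M0 + ln (r * (1 + 2 * r)))) => w.
have [wr|wr] := leP (2 * r) (cabs w).
  apply: (@le_trans _ _ (\int[mu]_(z in closed_disc r) (cst (ln (4 * r))%:E z))%E).
    apply: ge0_le_integral => //.
    - by move=> z zr; exact: log_kernel_ge0.
    - by apply: measurable_funTS; exact: measurable_log_kernel.
    - by move=> z zr; exact: log_kernel_far.
  by rewrite integral_cst// [X in (_ * X)%E](mur) mule1 lee_fin le_max lexx.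
have rw1 : 1 <= r * (1 + cabs w) by have := cabs_ge0 w; nra.
set c := ln (r * (1 + cabs w)).
have c0 : 0 <= c by rewrite ln_ge0.
apply: (@le_trans _ _ (M0 + c)%:E); last first.
  rewrite lee_fin le_max; apply/orP; right; rewrite lerD2l ler_ln ?posrE; nra.
pose h (N : nat) z := mine N%:R%:E (- lne (cabs (w - z))%:E)%E.
have mh N : measurable_fun setT (h N : @borelCx R -> \bar R).
  apply: measurable_mine; first exact: measurable_cst.
  exact: measurable_nlog.
have nlog_ge z : closed_disc r z -> ((- c)%:E <= - lne (cabs (w - z))%:E)%E.
  by move=> /(log_kernel_ge0 w r1); rewrite /log_kernel -/c addeC -leeBlDr// sub0e EFinN.
have hge N z : closed_disc r z -> ((- c)%:E <= h N z)%E.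
  move=> zr; rewrite le_min nlog_ge// andbT lee_fin.
  by rewrite (@le_trans _ _ 0)// oppr_le0.
have hle N z : (h N z <= N%:R%:E)%E by rewrite ge_min lexx.
have hint N : mu.-integrable (closed_disc r) (h N).
  apply: (@le_integrable _ _ _ _ _ _ _ (EFin \o cst (N%:R + c))) => //.
  - exact: measurable_funTS.
  - move=> z zr /=; move: (hge N z zr) (hle N z).
    case: (h N z) => [x| |]//; rewrite /= !lee_fin => cx xN.
    rewrite [leRHS]ger0_norm ?addr_ge0// ler_norml; apply/andP; split; last lra.
    by have : 0 <= (N%:R : R) by []; lra.
  - exact: finite_measure_integrable_cst.
have hT N : (\int[mu]_z h N z = \int[mu]_(z in closed_disc r) h N z)%E.
  rewrite [RHS]integral_mkcond; apply: ae_eq_integral => //.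
    by apply/(measurable_restrictT _ mD); exact: measurable_funTS.
  exists (~` closed_disc r); split.
  - exact: measurableC.
  - by apply: (etrans (probability_setC mu mD)); rewrite [X in (_ - X)%E](mur) subee.
  - move=> z /= H zr; apply: H => _; rewrite patchE.
    by rewrite mem_set.
have h_nd z : {homo (fun N => h N z) : n m / (n <= m)%N >-> (n <= m)%E}.
  move=> n m nm; rewrite /h le_min !ge_min lexx orbT andbT.
  by rewrite lee_fin ler_nat nm.
(* The truncated integrals increase, so their limit, the potential, dominates each. *)
have hM N : (\int[mu]_(z in closed_disc r) h N z <= M0%:E)%E.
  rewrite -hT; apply: le_trans (potB w).
  have nd : {homo (fun N => \int[mu]_(z in [set: @borelCx R]) h N z)%E :
      n m / (n <= m)%N >-> (n <= m)%E}.
    by move=> n m nm; rewrite !hT; apply: le_integral => // z _; exact: h_nd.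
  have /cvg_lim lim_eq := ereal_nondecreasing_cvgn nd.
  rewrite /log_potential -/(h _ _).
  rewrite [leRHS]lim_eq//; apply: ereal_sup_ubound; by exists N.
have kE z : closed_disc r z -> log_kernel r w z = limn (fun N => c%:E + h N z)%E.
  move=> zr; apply/esym/cvg_lim => //; apply: cvgeD; last 2 first.
  - exact: cvg_cst.
  - by apply: cvg_mine_nat; apply: lt_le_trans (nlog_ge z zr); exact: ltNyr.
  - exact: fin_num_adde_defr.
rewrite (eq_integral (fun z : @borelCx R => limn (fun N => c%:E + h N z)%E)); last first.
  by move=> z /set_mem zr; exact: kE.
rewrite monotone_convergence//; last 3 first.
- by move=> N; apply: measurable_funTS; apply: emeasurable_funD.
- move=> N z zr; move: (hge N z zr).
  by rewrite -[X in (0 <= X)%E]addeC -leeBlDr// sub0e EFinN.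
- by move=> z zr n m nm; apply: leeD2l; exact: h_nd.
have IE N : (\int[mu]_(z in closed_disc r) (c%:E + h N z) =
    c%:E + \int[mu]_(z in closed_disc r) h N z)%E.
  rewrite integralD//; last exact: finite_measure_integrable_cst.
  by rewrite [X in (X + _)%E]integral_cst// [X in (_ * X)%E](mur) mule1.
apply: lime_le.
  apply: ereal_nondecreasing_is_cvgn => n m nm; rewrite !IE leeD2l//.
  by apply: le_integral => // z _; exact: h_nd.
by apply: nearW => N; rewrite IE addeC EFinD leeD2r.
Qed.

End Potential.

Section PositiveCapacity.
Context {R : realType}.
Implicit Types (z w : Cx R) (p : {poly Cx R}) (r : R).

Lemma cap_gt0_measure (E : set (Cx R)) : (0 < cap E)%E ->
  exists n (mu : probability (@borelCx R) R) (M0 : R),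
    (mu (E `&` [set z | (cabs z <= n%:R)%R]) = 1)%E /\
    (forall z, log_potential mu z <= M0%:E)%E.
Proof.
move=> capE.
have [n capn] : exists n : nat, (0 < cap_bounded (E `&` [set z | (cabs z <= n%:R)%R]))%E.
  apply: contrapT => H; move: capE; rewrite /cap.
  have -> : (fun n : nat => cap_bounded (E `&` [set z | (cabs z <= n%:R)%R])) = cst 0%E.
    apply/funext => n /=; apply/eqP; rewrite eq_le expeR_ge0 andbT leNgt.
    by apply/negP => ?; apply: H; exists n.
  by rewrite lim_cst// ltxx.
exists n; move: capn; rewrite /cap_bounded; set I := ereal_inf _ => capn.
have /ereal_inf_lt[_ [mu muE <-] supy] : (I < +oo)%E.
  by rewrite ltey; apply: contraTneq capn => ->; rewrite /= ltxx.
exists mu.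
have [M0 supM] : exists M0 : R,
    (ereal_sup [set log_potential mu z | z in [set: Cx R]] <= M0%:E)%E.
  move: supy; case: (ereal_sup _) => [x _| |_]; [by exists x|by rewrite ltxx|exists 0; exact: leNye].
exists M0; split=> // z; apply: le_trans supM; apply: ereal_sup_ubound.
by exists z.
Qed.

(** The bounds on E are pointwise; measurability and countable additivity make them
    uniform on a set of positive measure. *)
Lemma coef_le_of_cap_gt0 (E F : set (Cx R)) (Q : nat -> {poly Cx R}) (D : nat) :
  closed F -> E = F `&` [set z | z != 0] -> (0 < cap E)%E ->
  (forall n, (size (Q n) <= (D * n).+1)%N) ->
  (forall s, E s -> exists C : R, forall n, n != 0%N -> cabs (Q n).[s] <= C ^+ n) ->
  exists2 B : R, 1 <= B &
    forall n l, n != 0%N -> cabs (Q n)`_l <= B ^+ n.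
Proof.
move=> Fcl EE capE sQ QE.
have [n0 [mu [M0 [muE potB]]]] := cap_gt0_measure capE.
set En : set (@borelCx R) := _ `&` _ in muE.
have mE : measurable En.
  rewrite /En EE; apply: measurableI; last exact: measurable_closed_disc.
  apply: measurableI.
    rewrite -[F]setCK; apply: measurableC. apply: sub_sigma_algebra.
    exact: closed_openC.
  rewrite (_ : [set z | z != 0] = [set z : Cx R | 0 < cabs z]).
    by apply: sub_sigma_algebra; exact: open_cabs_gt.
  by apply/funext => z; rewrite /= cabs_gt0.
pose r := Num.max 1 (n0%:R : R).
have r1 : 1 <= r by rewrite le_max lexx.
have mD := @measurable_closed_disc R r.
have ED : En `<=` closed_disc r.
  by move=> z [_ /= zn]; rewrite /closed_disc/= le_max zn orbT.
have muD : (mu (closed_disc r) = 1)%E.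
  apply/eqP; rewrite eq_le probability_le1//=.
  by apply: (@le_trans _ _ (mu En)); [rewrite muE|apply: le_measure => //; rewrite inE].
have [M MB] := log_kernel_integral_le r1 muD potB.
pose K (m : nat) : set (@borelCx R) :=
  En `&` \bigcap_k [set s | k != 0%N -> cabs (Q k).[s] <= m%:R ^+ k].
have mK m : measurable (K m).
  apply: measurableI => //; apply: bigcapT_measurable => k.
  have [->|k0] := eqVneq k 0%N.
    by rewrite (_ : [set _ | _] = setT)//; apply/seteqP.
  rewrite (_ : [set _ | _] = ~` [set s : Cx R | m%:R ^+ k < cabs (Q k).[s]]).
    by apply: measurableC; apply: sub_sigma_algebra; exact: open_cabs_horner_gt.
  apply/seteqP; split=> s /=; first by move=> /(_ isT) H; apply/negP; rewrite -leNgt.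
  by move=> /negP H _; rewrite leNgt.
have EK : En = \bigcup_m K m.
  apply/seteqP; split=> [s Es|s [m _ []]//].
  have [C CB] := QE s (proj1 Es).
  pose m := Num.bound `|C|; exists m => //; split=> // k _ /= k0.
  apply: (le_trans (CB k k0)); apply: (le_trans (ler_norm _)); rewrite normrX.
  by rewrite lerXn2r ?nnegrE//; apply/ltW/archi_boundP.
(* A countable union of null sets is null, and mu(En) = 1. *)
have [m Km] : exists m, (0 < mu (K m))%E.
  apply: contrapT => H; have : mu.-negligible En.
    rewrite EK; apply: negligible_bigcup => m; apply/negligibleP => //.
    apply/eqP; rewrite eq_le measure_ge0 andbT leNgt; apply/negP => ?.
    by apply: H; exists m.
  move=> /(negligibleP _ mE); rewrite [LHS](muE) => /eqP.
  by rewrite onee_eq0.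
have KD : K m `<=` closed_disc r by move=> z [/ED].
have KM w : (\int[mu]_(z in K m) log_kernel r w z <= M%:E)%E.
  apply: le_trans (MB w); apply: ge0_subset_integral => //.
    by apply: measurable_funTS; exact: measurable_log_kernel.
  by move=> z zr; exact: log_kernel_ge0.
have [B B1 BP] := coef_le_of_bounded_kernel r1 (mK m) KD Km KM.
exists (Num.max 1 (m%:R * B ^+ D)) => [|n l n0']; first by rewrite le_max lexx.
apply: (@le_trans _ _ (m%:R ^+ n * B ^+ (D * n))).
  by apply: BP => // z [_ /(_ n I)]; exact.
rewrite exprM -exprMn lerXn2r ?nnegrE ?le_max ?ler01 ?lexx ?orbT//.
by rewrite mulr_ge0// exprn_ge0// (le_trans ler01).
Qed.

End PositiveCapacity.

(** * The Laurent polynomials in s *)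

Section LaurentPolynomials.
Context {R : realType}.
Variables (g : ps2 R) (h : ps1 R) (sigma tau : int).
Hypothesis h0 : h 0%N = 0.

Let L := (`|sigma| + `|tau|)%N.

Lemma scaled_exponent_bounds i j n : (i < n.+1)%N -> (j < n.+1)%N ->
  0 <= sigma * i%:Z + tau * j%:Z + (L * n)%:Z <= (2 * L * n)%:Z.
Proof.
rewrite !ltnS => iN jN; rewrite !PoszM PoszD.
have := lez_abs sigma; have := lez_abs (- sigma).
have := lez_abs tau; have := lez_abs (- tau); rewrite !abszN.
move: (Posz `|sigma|) (Posz `|tau|) => a b *.
have : (i%:Z <= n%:Z) by []. have : (j%:Z <= n%:Z) by [].
have : (0 <= i%:Z) by []. have : (0 <= j%:Z) by [].
by move: (i%:Z) (j%:Z) (n%:Z) => x y z *; nia.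
Qed.

(** s^(L n) times the coefficient of x^n in g(s^sigma x, s^tau h(x)). *)
Definition subst_poly n : {poly Cx R} := \sum_(i < n.+1) \sum_(j < n.+1)
  (g i j * (ps1X ^+ i * h ^+ j) n) *:
    'X^(`|(sigma * i%:Z + tau * j%:Z + (L * n)%:Z)%R|%N).

Lemma size_subst_poly n : (size (subst_poly n) <= (2 * L * n).+1)%N.
Proof.
apply: (leq_trans (size_sum _ _ _)); apply/bigmax_leqP => i _.
apply: (leq_trans (size_sum _ _ _)); apply/bigmax_leqP => j _.
apply: (leq_trans (size_scale_leq _ _)); rewrite size_polyXn ltnS.
have := scaled_exponent_bounds (ltn_ord i) (ltn_ord j); lia.
Qed.

Lemma horner_subst_poly n (s : Cx R) : s != 0 ->
  (subst_poly n).[s] = s ^+ (L * n) *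
    ps2_subst g (ps1_scale (s ^ sigma) ps1X) (ps1_scale (s ^ tau) h) n.
Proof.
move=> s0; rewrite /subst_poly /ps2_subst horner_sum mulr_sumr.
apply: eq_bigr => i _; rewrite horner_sum mulr_sumr; apply: eq_bigr => j _.
rewrite hornerZ hornerXn !ps1_expE !ps1_scaleE.
have -> : ps1_mul ((ps1C (s ^ sigma) * ps1X) ^+ i) ((ps1C (s ^ tau) * h) ^+ j)
    = ps1C ((s ^ sigma) ^+ i * (s ^ tau) ^+ j) * (ps1X ^+ i * h ^+ j).
  by rewrite [LHS](_ : _ = (ps1C (s ^ sigma) * ps1X) ^+ i * (ps1C (s ^ tau) * h) ^+ j)//
     !exprMn mulrACA rmorphM !rmorphXn.
rewrite ps1_coefCM.
have /andP[ij0 _] := scaled_exponent_bounds (ltn_ord i) (ltn_ord j).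
have -> : s ^+ `|(sigma * i%:Z + tau * j%:Z + (L * n)%:Z)%R|%N =
    s ^ (sigma * i%:Z + tau * j%:Z + (L * n)%:Z).
  by rewrite -[in RHS](gez0_abs ij0).
rewrite !expfzDr// -!exprz_exp -!exprnP; move: (s ^ sigma) (s ^ tau) => x y; ring.
Qed.

Lemma coef_subst_poly n (p : int) : 0 <= p + (L * n)%:Z ->
  (subst_poly n)`_(`|(p + (L * n)%:Z)%R|%N) =
    ps2_subst (line_part g sigma tau p) ps1X h n.
Proof.
move=> p0; rewrite (ps2_subst_X _ h0 (leqnn n)) /subst_poly coef_sum.
apply: eq_bigr => i _; rewrite coef_sum; apply: eq_bigr => j _.
rewrite coefZ coefXn /line_part.
have /andP[ij0 _] := scaled_exponent_bounds (ltn_ord i) (ltn_ord j).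
rewrite -eqz_nat !gez0_abs// (inj_eq (addIr _)) eq_sym.
by case: eqP => _; rewrite ?mulr1// mulr0 mul0r.
Qed.

Lemma ps2_subst_line_out n (p : int) : p + (L * n)%:Z < 0 ->
  ps2_subst (line_part g sigma tau p) ps1X h n = 0.
Proof.
move=> p0; rewrite (ps2_subst_X _ h0 (leqnn n)).
rewrite big1// => i _; rewrite big1// => j _; rewrite /line_part.
case: eqP => [ijp|]; last by rewrite mul0r.
have /andP[] := scaled_exponent_bounds (ltn_ord i) (ltn_ord j).
by rewrite ijp leNgt p0.
Qed.

End LaurentPolynomials.


(** * Convergence of g *)

Theorem theorem1p1 (R : realType) (g : ps2 R) (h : ps1 R)
  (E : set (Cx R)) (sigma tau : int)
  (h_neq0 : exists n : nat, h n != 0)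
  (h_cvg : ps1_convergent h)
  (h0 : h 0%N = 0)
  (E_closed : exists2 F : set (Cx R), closed F & E = F `&` [set z | z != 0])
  (E_cap : (0 < cap E)%E)
  (st_neq0 : (sigma, tau) != (0, 0))
  (h_mono : 0 < sigma * tau ->
     ~ exists (k : nat) (b : Cx R),
         h = ps1_monomial b k /\ sigma * k%:Z - tau = 0)
  (g_cvg : forall s : Cx R, E s ->
     ps1_convergent
       (ps2_subst g (ps1_scale (s ^ sigma) (ps1_monomial 1 1))
                    (ps1_scale (s ^ tau) h))) :
  ps2_convergent g.
Proof.
case: E_closed => F Fcl EE.
pose L := (`|sigma| + `|tau|)%N.
have QE s : E s -> exists C : R,
    forall n, n != 0%N -> cabs (subst_poly g h sigma tau n).[s] <= C ^+ n.
  move=> Es; have s0 : s != 0 by move: Es; rewrite EE => -[].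
  have [C CB] := g_cvg s Es; exists (cabs s ^+ L * C) => n n0.
  rewrite horner_subst_poly// cabsM cabsX exprMn exprM.
  by rewrite ler_wpM2l ?exprn_ge0 ?cabs_ge0//; exact: CB.
have [B B1 BP] := coef_le_of_cap_gt0 Fcl EE E_cap
  (size_subst_poly g h sigma tau) QE.
have [b [k [u [rho1 [[hE b0 rho1_ge1 tu1] k0]]]]] := ps1_factor h_neq0 h_cvg.
have {}k0 := k0 h0.
(* One radius for both the bounds on the G_p and the tameness of u. *)
pose rho := Num.max rho1 B.
have rho_ge1 : 1 <= rho by rewrite le_max B1 orbT.
have tu : tame rho u.
  by apply: tame_le tu1; [exact: le_trans ler01 rho1_ge1|rewrite le_max lexx].
pose M := 1 + cabs (g 0%N 0%N).
have M1 : 1 <= M by rewrite lerDl cabs_ge0.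
have GB p : ps1_bounded M rho (ps2_subst (line_part g sigma tau p) ps1X h).
  case=> [|n].
    rewrite (ps2_subst_X _ h0 (leqnn 0)) !big_ord1 !expr0 mul1r !mulr1.
    rewrite /line_part; case: eqP => _.
      by rewrite lerDr ler01.
    by rewrite cabs0 (le_trans ler01).
  apply: (@le_trans _ _ (B ^+ n.+1)).
    have [p0|p0] := leP 0 (p + (L * n.+1)%:Z).
      by rewrite -(coef_subst_poly g h0 p0); exact: BP.
    rewrite (ps2_subst_line_out g h0 p0) cabs0 exprn_ge0// (le_trans ler01)//.
  rewrite -[leLHS]mul1r; apply: ler_pM => //; first by rewrite exprn_ge0// (le_trans ler01).
  by rewrite lerXn2r ?nnegrE ?(le_trans ler01 B1) ?(le_trans ler01 rho_ge1)// le_max lexx orbT.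
have [delta0|delta0] := eqVneq (tau - sigma * k%:Z) 0; last first.
  exact: (convergent_transversal hE b0 k0 rho_ge1 tu M1 GB).
have tauE : tau = sigma * k%:Z by apply/eqP; rewrite -subr_eq0 delta0.
have sigma0 : sigma != 0.
  by apply: contraNN st_neq0 => /eqP s0; rewrite tauE s0 mul0r.
apply: (convergent_tangent hE b0 k0 rho_ge1 tu M1 GB tauE sigma0).
apply/eqP => u1; case: h_mono.
  by rewrite tauE mulrA pmulr_lgt0 -?expr2 ?exprn_even_gt0//= ltz_nat.
exists k, b; split; last by rewrite tauE subrr.
rewrite hE u1 mulr1; apply/ps1P => n; rewrite ps1_coefCM -[ps1X ^+ k]mulr1.
rewrite ps1_coefXnM ps1_coef1 /ps1_monomial; case: (ltngtP n k) => nk.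
- by rewrite mulr0.
- by rewrite subn_eq0 leqNgt nk mulr0.
- by rewrite nk subnn mulr1.
Qed.
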